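(* Consider the interconnected system controlled by the receding-horizon distributed actor-critic learning algorithm described in the context. Assume that: (1) there exist local feedback control policies $u_i(e_{\mathcal N_i})$, $i=1,\dots,M$, such that $u=\mathrm{col}_i(u_i(e_{\mathcal N_i}))$ is a stabilizing control policy of the overall system; (2) the communication network is time-invariant and delay-free; (3) for all $i$ there are constants with $\|W_{c,i}^{*}\|\le W_{c,i}^{[m]}$, $\|\sigma_{c,i}\|\le\sigma_{c,i}^{[m]}$, $\|\kappa_{c,i}\|\le\kappa_{c,i}^{[m]}$, $\|W_{a,i}^{*}\|\le W_{a,i}^{[m]}$, $\|\sigma_{a,i}\|\le\sigma_{a,i}^{[m]}$, $\|\kappa_{a,i}\|\le\kappa_{a,i}^{[m]}$; (4) there exist finite scalars $\bar f_{\bar{\mathcal N}_i},\bar g_i$ with $\|\vec f_{\bar{\mathcal N}_i}\|\le\bar f_{\bar{\mathcal N}_i}$ and $\|g_i(e_i)\|\le\bar g_i$ for all admissible states and all $i$. If $$J(e(k))\le J^b(e^b(k))\qquad\text{for all }k\in\mathbb N,$$ where $J^b(e^b(k))$ is the cost along a baseline stabilizing policy as defined in the context, then the global state $e$ and control $u$ under the algorithm converge to the origin asymptotically.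
   Context: There are $M$ robots. Robot $i$ has error state $e_i\in\mathbb R^{n_i}$, input $u_i\in\mathbb R^{m_i}$ and a neighbor set $\mathcal N_i\subseteq\{1,\dots,M\}$ with $i\in\mathcal N_i$; $\bar{\mathcal N}_i=\{j:i\in\mathcal N_j\}$. Write $e_{\mathcal N_i}=\mathrm{col}_{j\in\mathcal N_i}(e_j)\in\mathbb R^{n_{\mathcal N_i}}$, $e=\mathrm{col}_i(e_i)\in\mathbb R^n$, $u=\mathrm{col}_i(u_i)$. The dynamics are $e_i(k+1)=f_i(e_{\mathcal N_i}(k))+g_i(e_i(k))u_i(k)$, $f_i,g_i$ smooth, $f_i(0)=0$; collected, $e(k+1)=F_c(e(k))+G_c(e(k))u(k)$. Unconstrained case. Time-invariant and delay-free network means that the sets $\mathcal N_i$ are fixed and information is exchanged without latency. Cost: $J(e(k))=\sum_{i=1}^MJ_i(e_{\mathcal N_i}(k))$, $J_i(e_{\mathcal N_i}(k))=\sum_{j=0}^{N-1}(\|e_{\mathcal N_i}(k+j)\|_{Q_i}^2+\|u_i(k+j)\|_{R_i}^2)+\|e_i(k+N)\|_{P_i}^2$, $\|x\|_Q^2=x^\top Qx$, $Q_i,R_i,P_i$ symmetric positive definite, where $P_i$ solves $F_i^\top P_iF_i-\bar P_i=-\beta_i(Q_i+K_{\mathcal N_i}^\top R_iK_{\mathcal N_i})+\Gamma_{\mathcal N_i}$. Here $F_i=A_{\mathcal N_i}+B_iK_{\mathcal N_i}$, $(A_{\mathcal N_i},B_i)$ is the linearization of the local dynamics at the origin, $K_{\mathcal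 N_i}$ are gains such that $u=\mathrm{col}_i(K_{\mathcal N_i}e_{\mathcal N_i})$ is stabilizing, $\beta_i$ is a tuning parameter, $\bar P_i=W_i\Upsilon_i^\top P_i\Upsilon_iW_i^\top$ with selection matrices $e_i=\Upsilon_ie$, $e_{\mathcal N_i}=W_ie$, and $\sum_iW_i^\top\Gamma_{\mathcal N_i}W_i\le0$. Baseline: $\bm u^b=\mathrm{col}_i\bm u_i^b$ is a baseline stabilizing control policy sequence, $e^b$ the corresponding state evolution, and $J^b(e^b(k))=\sum_iJ_i^b(e^b_{\mathcal N_i}(k))$ the cost above evaluated under it; it satisfies $J^b(e^b(k+1))-J^b(e^b(k))<-s(e^b(k),u^b(k))$ for all $k$, with $s(\cdot,\cdot)$ a class $\mathcal K$ function. Actor-critic: $\hat\lambda_i(e_{\mathcal N_i}(\tau))=W_{c,i}^\top\sigma_{c,i}(e_{\mathcal N_i}(\tau),\tau)$ (critic, approximating $\partial J_i/\partial e_{\mathcal N_i}$) and $\hat u_i(e_{\mathcal N_i}(\tau))=W_{a,i}^\top\sigma_{a,i}(e_{\mathcal N_i}(\tau),\tau)$ (actor), $\sigma_{c,i},\sigma_{a,i}$ vectors of basis functions. Targets: $\lambda_i^d(\tau)=2Q_ie_{\mathcal N_i}(\tau)+\sum_{j\in\bar{\mathcal N}_i}(\partial f_j(e_{\mathcal N_j}(\tau))/\partial e_{\mathcal N_i}(\tau))^\top\hat\lambda_i^{[j]}(\tau+1)$ and $u_{o,i}^d(\tau)=-\sum_{j\in\bar{\mathcal N}_i}g_i^\top(e_i(\tau))\hat\lambda_j^{[i]}(\tau+1)$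 ($\hat\lambda_i^{[j]}$: entries of $\hat\lambda_i$ corresponding to robot $j$). With $\delta_{c,i}=\|\lambda_i^d-\hat\lambda_i\|^2$, $\delta_{a,i}=\|u_{o,i}^d-2R_i\hat u_i\|^2$, updates are $W_{c,i}\leftarrow W_{c,i}-\gamma_{c,i}\,\partial\delta_{c,i}/\partial W_{c,i}$, $W_{a,i}\leftarrow W_{a,i}-\gamma_{a,i}\,\partial\delta_{a,i}/\partial W_{a,i}$, with $\gamma_{c,i},\gamma_{a,i}>0$. Algorithm: weights are initialized randomly. At each time $k$, starting from the current weights, repeat sweeps $\tau=k,\dots,k+N-1$ (predict $e_i(\tau+1)$ from the dynamics with $\hat u_i$, compute the targets, update the weights, for all $i$) until a stopping criterion (small weight change or maximal number of sweeps) is met; compute $J(e(k))$ under the learned policy; if $J(e(k))\le J^b(e^b(k))$ is violated, re-initialize the weights and repeat; finally apply $\hat u_i(e_{\mathcal N_i}(k))$ to the system and move to $k+1$. Optimal weights and reconstruction errors: $\lambda_i^*=(W_{c,i}^* )^\top\sigma_{c,i}+\kappa_{c,i}$ and $u_i^*=(W_{a,i}^* )^\top\sigma_{a,i}+\kappa_{a,i}$ are the optimal costate and policy. $\vec f_{\bar{\mathcal N}_i}$ is the row collection of $(\partial f_j(e_{\mathcal N_j}(\tau))/\partial e_{\mathcal N_i}(\tau))^\top$, $j\in\bar{\mathcal N}_i$. *)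

(* Defs.v *)
From mathcomp Require Export all_boot all_order all_algebra.
From mathcomp Require Export all_classical all_reals all_analysis.
Export Order.TTheory GRing.Theory Num.Theory numFieldNormedType.Exports.

Set Implicit Arguments.
Unset Strict Implicit.
Unset Printing Implicit Defensive.

Local Open Scope classical_set_scope.
Local Open Scope ring_scope.

Section calculus.
Context {R : realType}.

(* Euclidean norm of a vector, Frobenius norm of a matrix (the library norm
   `|_| on matrices is the sup norm; both induce the same topology). *)
Definition fnorm p q (A : 'M[R]_(p, q)) : R :=
  Num.sqrt (\sum_i \sum_j A i j ^+ 2).

(* ||x||_A^2 = x^T A x *)
Definition qform p (A : 'M[R]_p) (x : 'cV[R]_p) : R := (x^T *m A *m x) 0 0.

Definition posdef p (A : 'M[R]_p) : Prop :=
  A^T = A /\ forall x, x != 0 -> 0 < qform A x.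

Definition negsemidef p (A : 'M[R]_p) : Prop := forall x, qform A x <= 0.

Fixpoint Ck (V W : normedModType R) (k : nat) (f : V -> W) : Prop :=
  if k is k'.+1 then
    (forall x, differentiable f x) /\ (forall v, Ck k' (fun x => 'D_v f x))
  else continuous f.

Definition smooth (V W : normedModType R) (f : V -> W) : Prop :=
  forall k, Ck k f.

(* The library Jacobian is for row vectors and is the transpose of the usual
   matrix; here (jac f x) a b = d f_a / d x_b at x. *)
Definition jac p q (f : 'cV[R]_p -> 'cV[R]_q) (x : 'cV[R]_p) : 'M[R]_(q, p) :=
  (jacobian (fun r : 'rV[R]_p => (f r^T)^T) x^T)^T.

Definition mxgrad p q (phi : 'M[R]_(p, q) -> R^o) (X : 'M[R]_(p, q)) :
  'M[R]_(p, q) := \matrix_(a, b) 'D_(delta_mx a b) phi X.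

(* Class K function of two nonnegative arguments, used as s(||e||, ||u||). It
   vanishes at (0, 0) only, not on the axes. *)
Definition classK2 (s : R -> R -> R) : Prop :=
  [/\ {within [set p : R * R | 0 <= p.1 /\ 0 <= p.2],
         continuous (fun p => s p.1 p.2)},
      s 0 0 = 0,
      (forall a a' b, 0 <= a -> a < a' -> 0 <= b -> s a b < s a' b) &
      (forall a b b', 0 <= a -> 0 <= b -> b < b' -> s a b < s a b')].

End calculus.

(* A fixed record of neighbour sets, always evaluated at the current time:
   the communication network is time-invariant and delay-free. *)
Record network := Network {
  robots : nat;
  sdim : 'I_robots -> nat;
  idim : 'I_robots -> nat;
  nbr : 'I_robots -> {set 'I_robots};
  nbr_refl : forall i, i \in nbr i }.

Arguments sdim {_}.
Arguments idim {_}.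
Arguments nbr {_}.

Section topology.
Context {net : network}.
Implicit Type i : 'I_(robots net).

Definition nbr_in i : {set 'I_(robots net)} := [set j | i \in nbr j].

Definition ndim i : nat := (\sum_(j < #|nbr i|) sdim (enum_val j))%N.

Definition state (R : realType) := 'cV[R]_(\sum_i sdim (n := net) i).
Definition input (R : realType) := 'cV[R]_(\sum_i idim (n := net) i).

Context {R : realType}.

(* Selection matrices: e_i = Ups i *m e and e_(N_i) = Wsel i *m e. *)
Definition Ups i : 'M[R]_(sdim i, \sum_j sdim (n := net) j) := submxcol 1%:M i.

Definition Wsel i : 'M[R]_(ndim i, \sum_j sdim (n := net) j) :=
  \mxcol_(j < #|nbr i|) Ups (enum_val j).

(* The entries of l : R^(n_(N_i)) belonging to robot j; 0 if j \notin nbr i. *)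
Definition entries i j (l : 'cV[R]_(ndim i)) : 'cV[R]_(sdim j) :=
  Ups j *m ((Wsel i)^T *m l).

End topology.

Arguments state : clear implicits.
Arguments input : clear implicits.

Record dynamics (R : realType) (net : network) := Dynamics {
  drift : forall i : 'I_(robots net), 'cV[R]_(ndim i) -> 'cV[R]_(sdim i);
  gain : forall i : 'I_(robots net), 'cV[R]_(sdim i) -> 'M[R]_(sdim i, idim i);
  drift_smooth : forall i, smooth (@drift i);
  gain_smooth : forall i, smooth (@gain i);
  drift0 : forall i, @drift i 0 = 0 }.

Arguments drift {_ _}.
Arguments gain {_ _}.

Section closed_loops.
Context {R : realType} {net : network} (dyn : dynamics R net).
Implicit Types (x : state net R) (u : input net R).

(* A possibly time-varying control policy for the overall system. *)
Definition policy := nat -> state net R -> input net R.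

Definition step x u : state net R :=
  \mxcol_i (drift dyn i (Wsel i *m x) + gain dyn i (Ups i *m x) *m submxcol u i).

(* State reached from x, l steps after time t. *)
Fixpoint traj (pol : policy) (t : nat) x (l : nat) : state net R :=
  if l is l'.+1 then
    step (traj pol t x l') (pol (t + l')%N (traj pol t x l'))
  else x.

Definition local_policy
    (mu : forall i : 'I_(robots net), 'cV[R]_(ndim i) -> 'cV[R]_(idim i)) :
  policy := fun _ x => \mxcol_i mu i (Wsel i *m x).

(* The origin is asymptotically stable: Lyapunov stable and attractive. *)
Definition stabilizing (pol : policy) : Prop := forall t : nat,
  (forall eps : R, 0 < eps -> exists2 d : R, 0 < d &
     forall x, fnorm x < d -> forall l, fnorm (traj pol t x l) < eps) /\
  (exists2 r : R, 0 < r &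
     forall x, fnorm x < r -> traj pol t x @ \oo --> (0 : state net R)).

End closed_loops.

Record cost_data (R : realType) (net : network) := CostData {
  horizon : nat;
  horizon_gt0 : (0 < horizon)%N;
  Qw : forall i : 'I_(robots net), 'M[R]_(ndim i);
  Rw : forall i : 'I_(robots net), 'M[R]_(idim i);
  Pw : forall i : 'I_(robots net), 'M[R]_(sdim i);
  Qw_posdef : forall i, posdef (Qw i);
  Rw_posdef : forall i, posdef (Rw i);
  Pw_posdef : forall i, posdef (Pw i) }.

Arguments horizon {_ _}.
Arguments Qw {_ _}.
Arguments Rw {_ _}.
Arguments Pw {_ _}.

Section cost.
Context {R : realType} {net : network}.
Variables (dyn : dynamics R net) (C : cost_data R net).
Implicit Types (x : state net R) (pol : policy (R := R) (net := net)).

(* Cost of robot i over L steps, starting at time t in state x, under pol. *)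
Definition robot_cost (L : nat) pol (t : nat) (i : 'I_(robots net)) x : R :=
  let z := traj dyn pol t x in
  \sum_(l < L) (qform (Qw C i) (Wsel i *m z l)
                + qform (Rw C i) (submxcol (pol (t + l)%N (z l)) i))
  + qform (Pw C i) (Ups i *m z L).

Definition total_cost (L : nat) pol (t : nat) x : R :=
  \sum_i robot_cost L pol t i x.

(* pol j, for j < N, is the optimal policy at stage j of the horizon: it
   minimizes the total cost-to-go from every state. The problem posed at time k
   does not depend on k, so stages are counted from 0. *)
Definition optimal_policy pol : Prop :=
  forall (j : nat), (j < horizon C)%N -> forall pol' x,
    total_cost (horizon C - j) pol j x <= total_cost (horizon C - j) pol' j x.

(* lam j i = d J_i / d e_(N_i) along the optimal policy pol, at stage j;
   the gradient is only required to exist on X. *)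
Definition optimal_costate (X : set (state net R)) pol
    (lam : nat -> forall i : 'I_(robots net), state net R -> 'cV[R]_(ndim i)) :
  Prop := forall j i x, (j < horizon C)%N -> X x ->
    let J : state net R -> R^o := robot_cost (horizon C - j) pol j i in
    differentiable J x /\ lam j i x = Wsel i *m mxgrad J x.

(* Linearization of the local dynamics at the origin. *)
Definition linA i : 'M[R]_(sdim i, ndim i) := jac (drift dyn i) 0.
Definition linB i : 'M[R]_(sdim i, idim i) := gain dyn i 0.

Definition terminal_condition
    (K : forall i : 'I_(robots net), 'M[R]_(idim i, ndim i))
    (beta : 'I_(robots net) -> R)
    (Gamma : forall i : 'I_(robots net), 'M[R]_(ndim i)) : Prop :=
  [/\ stabilizing dyn (local_policy (fun i v => K i *m v)),
      (forall i,
         let F := linA i + linB i *m K i in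
         let Pbar := Wsel i *m (Ups i)^T *m Pw C i *m Ups i *m (Wsel i)^T in
         F^T *m Pw C i *m F - Pbar =
         - (beta i *: (Qw C i + (K i)^T *m Rw C i *m K i)) + Gamma i) &
      negsemidef (\sum_i (Wsel i)^T *m Gamma i *m Wsel i)].

(* pol is a baseline policy sequence; x0 is the initial baseline state. *)
Definition baseline_state pol x0 (k : nat) : state net R := traj dyn pol 0 x0 k.
Definition baseline_input pol x0 (k : nat) : input net R :=
  pol k (baseline_state pol x0 k).
Definition baseline_cost pol x0 (k : nat) : R :=
  total_cost (horizon C) pol k (baseline_state pol x0 k).

Definition baseline pol x0 : Prop :=
  stabilizing dyn pol /\
  exists2 s : R -> R -> R, classK2 s &
    forall k, baseline_cost pol x0 k.+1 - baseline_cost pol x0 k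
              < - s (fnorm (baseline_state pol x0 k))
                    (fnorm (baseline_input pol x0 k)).

(* d f_j(e_(N_j)) / d e_(N_i) at e = x: the columns of the Jacobian of
   e |-> f_j(e_(N_j)) indexed by the components of e_(N_i). *)
Definition dfde (j i : 'I_(robots net)) x : 'M[R]_(sdim j, ndim i) :=
  jac (fun y : state net R => drift dyn j (Wsel j *m y)) x *m (Wsel i)^T.

Definition fvec i x :
  'M[R]_(ndim i, \sum_(j < #|nbr_in i|) sdim (n := net) (enum_val j)) :=
  \mxrow_(j < #|nbr_in i|) (dfde (enum_val j) i x)^T.

End cost.

Record actor_critic (R : realType) (net : network) := ActorCritic {
  cdim : 'I_(robots net) -> nat;
  adim : 'I_(robots net) -> nat;
  sigc : forall i, 'cV[R]_(ndim i) -> nat -> 'cV[R]_(cdim i);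
  siga : forall i, 'cV[R]_(ndim i) -> nat -> 'cV[R]_(adim i);
  gamc : 'I_(robots net) -> R;
  gama : 'I_(robots net) -> R;
  gamc_gt0 : forall i, 0 < gamc i;
  gama_gt0 : forall i, 0 < gama i;
  wtol : R;              (* threshold for a small weight change *)
  max_sweeps : nat;
  max_sweeps_gt0 : (0 < max_sweeps)%N }.

Arguments cdim {_ _}.
Arguments adim {_ _}.
Arguments sigc {_ _}.
Arguments siga {_ _}.
Arguments gamc {_ _}.
Arguments gama {_ _}.
Arguments wtol {_ _}.
Arguments max_sweeps {_ _}.

Record weights (R : realType) (net : network) (ac : actor_critic R net) :=
  Weights {
    wc : forall i : 'I_(robots net), 'M[R]_(cdim ac i, ndim i);
    wa : forall i : 'I_(robots net), 'M[R]_(adim ac i, idim i) }.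

Section learning.
Context {R : realType} {net : network}.
Variables (dyn : dynamics R net) (C : cost_data R net) (ac : actor_critic R net).
Implicit Types (x : state net R) (w : weights ac) (t k : nat).

Definition critic w t i x : 'cV[R]_(ndim i) :=
  (wc w i)^T *m sigc ac i (Wsel i *m x) t.

Definition actor w t i x : 'cV[R]_(idim i) :=
  (wa w i)^T *m siga ac i (Wsel i *m x) t.

Definition learned_policy w : policy (R := R) (net := net) :=
  fun t x => \mxcol_i actor w t i x.

(* In both targets x and x' are the states at times t and t + 1. *)
Definition costate_target w t x x' i : 'cV[R]_(ndim i) :=
  2 *: (Qw C i *m (Wsel i *m x))
  + \sum_(j in nbr_in i) (dfde dyn j i x)^T *m entries j (critic w t.+1 i x').

Definition control_target w t x x' i : 'cV[R]_(idim i) :=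
  - \sum_(j in nbr_in i)
      (gain dyn i (Ups i *m x))^T *m entries i (critic w t.+1 j x').

(* One prediction-and-update step. The targets are computed with the current
   weights and held fixed while differentiating the squared errors; all robots
   are updated simultaneously. *)
Definition learn_step t (xw : state net R * weights ac) :
    state net R * weights ac :=
  let: (x, w) := xw in
  let x' := step dyn x (learned_policy w t x) in
  let deltac i (V : 'M[R]_(cdim ac i, ndim i)) : R^o :=
    fnorm (costate_target w t x x' i - V^T *m sigc ac i (Wsel i *m x) t) ^+ 2 in
  let deltaa i (V : 'M[R]_(adim ac i, idim i)) : R^o :=
    fnorm (control_target w t x x' i
           - 2 *: (Rw C i *m (V^T *m siga ac i (Wsel i *m x) t))) ^+ 2 in
  (x', Weights
         (fun i => wc w i - gamc ac i *: mxgrad (deltac i) (wc w i))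
         (fun i => wa w i - gama ac i *: mxgrad (deltaa i) (wa w i))).

(* Times t = k, ..., k + N - 1, the prediction starting at x. *)
Definition sweep k x w : weights ac :=
  (iteri (horizon C) (fun j => learn_step (k + j)%N) (x, w)).2.

Definition small_change w w' : Prop := forall i,
  fnorm (wc w' i - wc w i) <= wtol ac /\ fnorm (wa w' i - wa w i) <= wtol ac.

(* Starting from w, sweeps are repeated until the weight change is small or
   the maximal number of sweeps is reached; w' is the outcome. *)
Definition learn k x w w' : Prop :=
  let sw r := iter r (sweep k x) w in
  exists r : nat,
    [/\ (0 < r <= max_sweeps ac)%N, w' = sw r,
        small_change (sw r.-1) (sw r) \/ r = max_sweeps ac &
        forall q, (0 < q < r)%N -> ~ small_change (sw q.-1) (sw q)].

Definition predicted_cost w k x : R :=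
  total_cost dyn C (horizon C) (learned_policy w) k x.

(* Learning at time k from weights w, with cost bound c: an outcome violating
   the bound is discarded and learning restarts from re-initialized weights w2.
   Random (re-)initialization is rendered by letting w2 be arbitrary. That the
   final outcome w' meets the bound is not built in here. *)
Inductive learning_phase (c : R) k x : weights ac -> weights ac -> Prop :=
| LearnEnd w w' : learn k x w w' -> learning_phase c k x w w'
| LearnRetry w w1 w2 w' : learn k x w w1 -> ~ predicted_cost w1 k x <= c ->
    learning_phase c k x w2 w' -> learning_phase c k x w w'.

(* A run of the receding-horizon algorithm, with Jb k the baseline cost at time
   k: w k are the weights before learning at time k (w 0 being arbitrary) and
   w k.+1 the learned ones, used to control the system at time k. *)
Definition algorithm_run (Jb : nat -> R) (e : nat -> state net R)
    (u : nat -> input net R) (w : nat -> weights ac) : Prop :=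
  forall k, [/\ learning_phase (Jb k) k (e k) (w k) (w k.+1),
                u k = learned_policy (w k.+1) k (e k) &
                e k.+1 = step dyn (e k) (u k)].

Section boundedness.
Variable X : set (state net R).   (* the admissible states *)

(* The reconstruction errors in the horizon problem posed at time k, at stage
   j (time k + j), are the optimal costate and policy minus what the
   network outputs with the optimal weights wstar. *)
Definition critic_error
    (lam : nat -> forall i : 'I_(robots net), state net R -> 'cV[R]_(ndim i))
    wstar k j i x : 'cV[R]_(ndim i) :=
  lam j i x - critic wstar (k + j)%N i x.

Definition actor_error (ustar : policy (R := R) (net := net)) wstar k j i x :
  'cV[R]_(idim i) := submxcol (ustar j x) i - actor wstar (k + j)%N i x.

Definition bounded_critic lam wstar : Prop :=
  forall i, exists Wm sm km : R,
    [/\ fnorm (wc wstar i) <= Wm,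
        (forall t x, X x -> fnorm (sigc ac i (Wsel i *m x) t) <= sm) &
        (forall k j x, (j < horizon C)%N -> X x ->
           fnorm (critic_error lam wstar k j i x) <= km)].

Definition bounded_actor ustar wstar : Prop :=
  forall i, exists Wm sm km : R,
    [/\ fnorm (wa wstar i) <= Wm,
        (forall t x, X x -> fnorm (siga ac i (Wsel i *m x) t) <= sm) &
        (forall k j x, (j < horizon C)%N -> X x ->
           fnorm (actor_error ustar wstar k j i x) <= km)].

Definition bounded_dynamics : Prop :=
  forall i, exists fbar gbar : R, forall x, X x ->
    fnorm (fvec dyn i x) <= fbar /\ fnorm (gain dyn i (Ups i *m x)) <= gbar.

End boundedness.
End learning.

(* Main.v *)
(** The baseline cost is nonnegative and decreases at each time by more than
    s(||e^b||, ||u^b||), so these decrements tend to 0 and, s being strictly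
    increasing in each argument, so do e^b and u^b. Hence the baseline cost,
    a quadratic function of finitely many of their shifts, tends to 0. The
    learned cost is squeezed between 0 and the baseline cost; it dominates its
    stage-0 term, which is positive definite in the actual (e(k), u(k)). *)

Require Import Defs.
From mathcomp Require Import ring.

Set Implicit Arguments.
Unset Strict Implicit.
Unset Printing Implicit Defensive.

Local Open Scope classical_set_scope.
Local Open Scope ring_scope.

(** * Limits along a filter, for scalars and matrices *)

Section limits.
Context {R : realType} {T : Type} {F : set_system T} {FF : Filter F}.

Lemma cvg_sumr (I : Type) (r : seq I) (P : pred I) (f : I -> T -> R)
    (l : I -> R) :
  (forall i, P i -> f i t @[t --> F] --> l i) ->
  \sum_(i <- r | P i) f i t @[t --> F] --> \sum_(i <- r | P i) l i.
Proof. by apply: cvg_big; exact: add_continuous. Qed.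

Lemma cvg0_sumr (I : Type) (r : seq I) (P : pred I) (f : I -> T -> R) :
  (forall i, P i -> f i t @[t --> F] --> 0) ->
  \sum_(i <- r | P i) f i t @[t --> F] --> 0.
Proof. by move=> /(@cvg_sumr _ r); rewrite big1_eq. Qed.

Lemma cvg0_sqr (f : T -> R) : f t ^+ 2 @[t --> F] --> 0 -> f t @[t --> F] --> 0.
Proof.
move=> f20; apply/cvgr0Pnorm_lt => eps eps0.
have /cvgr0Pnorm_lt/(_ _ (exprn_gt0 2 eps0)) := f20.
apply: filterS => t; rewrite normrX => ft.
by rewrite -(ltr_pXn2r (n := 2)) ?nnegrE // ltW.
Qed.

Lemma cvg_mxP m n (M : T -> 'M[R]_(m, n)) (L : 'M[R]_(m, n)) :
  M t @[t --> F] --> L <-> forall i j, M t i j @[t --> F] --> L i j.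
Proof.
split=> [ML i j|ML].
  apply: (@cvg_comp _ _ _ M (fun A => A i j) F (nbhs L) (nbhs (L i j)) ML).
  exact: coord_continuous.
(* There are finitely many entries, so the filter contains the intersection of the entrywise
   conditions. *)
apply/cvg_ballP => eps eps0; near=> t; split=> //; near: t.
apply: filter_forall => i; apply: filter_forall => j.
exact: (cvg_ball (ML i j)).
Unshelve. all: by end_near. Qed.

Lemma cvg_mulmx m n p (A : T -> 'M[R]_(m, n)) (B : T -> 'M[R]_(n, p))
    (A0 : 'M[R]_(m, n)) (B0 : 'M[R]_(n, p)) :
  A t @[t --> F] --> A0 -> B t @[t --> F] --> B0 ->
  A t *m B t @[t --> F] --> A0 *m B0.
Proof.
move=> /cvg_mxP AA0 /cvg_mxP BB0; apply/cvg_mxP => i j.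
rewrite !mxE; under eq_fun do rewrite mxE.
by apply: cvg_sumr => k _; apply: cvgM.
Qed.

Lemma cvg_submxcolP p (d : 'I_p -> nat) n
    (x : T -> 'M[R]_(\sum_i d i, n)) (x0 : 'M[R]_(\sum_i d i, n)) :
  x t @[t --> F] --> x0 <->
  forall i, submxcol (x t) i @[t --> F] --> submxcol x0 i.
Proof.
split=> [/cvg_mxP xx0 i|xx0].
  apply/cvg_mxP => a b; rewrite mxE; under eq_fun do rewrite mxE.
  exact: xx0.
(* Row [a] of the stack is row [tagnat.sig2 a] of block [tagnat.sig1 a]. *)
apply/cvg_mxP => a b; rewrite -[x0]submxcolK mxE.
under eq_fun => t do rewrite -[x t]submxcolK mxE.
by have /cvg_mxP/(_ (tagnat.sig2 a) b) := xx0 (tagnat.sig1 a).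
Qed.

Lemma cvg_qform p (A : 'M[R]_p) (x : T -> 'cV[R]_p) (x0 : 'cV[R]_p) :
  x t @[t --> F] --> x0 -> qform A (x t) @[t --> F] --> qform A x0.
Proof.
move=> xx0; have xTx0 : (x t)^T @[t --> F] --> x0^T.
  apply/cvg_mxP => i j; rewrite mxE; under eq_fun do rewrite mxE.
  by have /cvg_mxP/(_ j i) := xx0.
have : (x t)^T *m A *m x t @[t --> F] --> x0^T *m A *m x0.
  by apply: cvg_mulmx xx0; apply: cvg_mulmx xTx0 _; exact: cvg_cst.
by move=> /cvg_mxP/(_ 0 0).
Qed.

(** Each squared entry is squeezed between 0 and the squared Frobenius norm. This passes from
    [fnorm] to the sup-norm topology. *)
Lemma cvg0_fnorm m n (A : T -> 'M[R]_(m, n)) :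
  fnorm (A t) @[t --> F] --> 0 -> A t @[t --> F] --> (0 : 'M[R]_(m, n)).
Proof.
move=> A0; apply/cvg_mxP => i j; rewrite mxE.
have A0' : fnorm (A t) ^+ 2 @[t --> F] --> 0.
  by rewrite -[X in _ --> X](mul0r 0); apply: cvgM.
apply: cvg0_sqr; apply: (squeeze_cvgr _ (cvg_cst 0) A0'); near=> t.
have sq_ge0 k l : 0 <= A t k l ^+ 2 by exact: sqr_ge0.
rewrite sqr_ge0 /= sqr_sqrtr; last by do 2!apply: sumr_ge0 => ? _.
rewrite (bigD1 i) //= (bigD1 j) //= -addrA lerDl addr_ge0 //.
  exact: sumr_ge0.
by do 2!apply: sumr_ge0 => ? _.
Unshelve. all: by end_near. Qed.

End limits.

(** * Positive definite quadratic forms *)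

Section quadratic_forms.
Context {R : realType} {p : nat} {A : 'M[R]_p}.

Lemma qform0 : qform A 0 = 0.
Proof. by rewrite /qform mulmx0 mxE. Qed.

Hypothesis Apd : posdef A.

Lemma posdef_ge0 x : 0 <= qform A x.
Proof.
have [->|x0] := eqVneq x 0; first by rewrite qform0.
exact/ltW/Apd.2.
Qed.

(** A nonzero row v with v A = 0 would make the form vanish at the transpose of v. *)
Lemma posdef_unitmx : A \in unitmx.
Proof.
rewrite -row_free_unit; apply: inj_row_free => v vA0.
apply/eqP; rewrite -trmx_eq0; apply/negP => /negP /Apd.2.
by rewrite /qform trmxK vA0 mul0mx mxE ltxx.
Qed.

Lemma posdef_CauchySchwarz x y :
  (y^T *m A *m x) 0 0 ^+ 2 <= qform A y * qform A x.
Proof.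
have [->|y0] := eqVneq y 0.
  by rewrite trmx0 !mul0mx mxE expr0n qform0 mul0r.
have qy0 : 0 < qform A y := Apd.2 _ y0.
set b := (y^T *m A *m x) 0 0.
have xAy : x^T *m A *m y = (y^T *m A *m x)^T.
  by rewrite !trmx_mul trmxK Apd.1 mulmxA.
(* Up to the factor [qform A y], this is the component of x that is A-orthogonal to y; scaling by it
   avoids a division. *)
have := posdef_ge0 (qform A y *: x - b *: y).
have -> : qform A (qform A y *: x - b *: y) =
    qform A y * (qform A y * qform A x - b ^+ 2).
  rewrite {1}/qform mulmxBr [(_ - _)^T]linearB /= [(_ *: x)^T]linearZ /=.
  rewrite [(_ *: y)^T]linearZ /= !mulmxBl -!scalemxAl -!scalemxAr xAy.
  (* With the three 1 x 1 products abstracted, what remains is a polynomial identity in their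
     entries. *)
  rewrite {}/b /qform; move: (x^T *m A *m x) (y^T *m A *m x) (y^T *m A *m y).
  by move=> Axx Ayx Ayy; rewrite !mxE; ring.
by rewrite pmulr_rge0 // subr_ge0.
Qed.

Lemma cvg0_qform (T : Type) (F : set_system T) {FF : Filter F}
    (x : T -> 'cV[R]_p) :
  qform A (x t) @[t --> F] --> 0 -> x t @[t --> F] --> (0 : 'cV[R]_p).
Proof.
move=> qx0; apply/cvg_mxP => i j; rewrite ord1 mxE; apply: cvg0_sqr.
(* A y is the i-th unit vector, so Cauchy-Schwarz bounds the square of the i-th
   coordinate of x t by qform A y * qform A (x t), without compactness. *)
pose y : 'cV[R]_p := invmx A *m delta_mx i 0.
have qx0' : qform A y * qform A (x t) @[t --> F] --> 0.
  by rewrite -[X in _ --> X](mulr0 (qform A y)); apply: cvgM => //;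
    exact: cvg_cst.
apply: (squeeze_cvgr _ (cvg_cst 0) qx0'); near=> t.
rewrite sqr_ge0 /=; apply: le_trans (posdef_CauchySchwarz _ _).
rewrite trmx_mul trmx_inv Apd.1 -mulmxA mulmxA mulmxKV ?posdef_unitmx //.
by rewrite trmx_delta -rowE mxE.
Unshelve. all: by end_near. Qed.

End quadratic_forms.

(** * Class K functions and vanishing decrements *)

Section classK.
Context {R : realType} {s : R -> R -> R}.
Hypothesis sK : classK2 s.

Lemma classK2_le a a' b b' :
  0 <= a <= a' -> 0 <= b <= b' -> s a b <= s a' b'.
Proof.
case: sK => _ _ sl sr /andP[a0 aa'] /andP[b0 bb'].
apply: (@le_trans _ _ (s a' b)).
  by move: aa'; rewrite le_eqVlt => /predU1P[->//|/sl]; move=> /(_ _ a0 b0)/ltW.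
move: bb'; rewrite le_eqVlt => /predU1P[->//|bb'].
by apply/ltW/sr => //; exact: le_trans aa'.
Qed.

Lemma classK2_ge0 a b : 0 <= a -> 0 <= b -> 0 <= s a b.
Proof.
by case: (sK) => _ s0 _ _ a0 b0; rewrite -[leLHS]s0 classK2_le ?lexx ?a0 ?b0.
Qed.

(** By monotonicity, [a t >= eps] forces [s (a t) (b t) >= s eps 0], a positive threshold since
    [s 0 0 = 0]; eventually s lies below it. The second argument is treated symmetrically with
    [s 0 eps]. *)
Lemma cvg0_classK2 (T : Type) (F : set_system T) {FF : Filter F} (a b : T -> R) :
  (forall t, 0 <= a t) -> (forall t, 0 <= b t) ->
  s (a t) (b t) @[t --> F] --> 0 ->
  a t @[t --> F] --> 0 /\ b t @[t --> F] --> 0.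
Proof.
case: (sK) => _ s0 sl sr a0 b0 sab0.
split; apply/cvgr0Pnorm_lt => eps eps0.
- have /(cvgr0Pnorm_lt _).1/(_ (s eps 0)) := sab0.
  rewrite -{1}[X in X < _]s0 sl // => /(_ isT).
  apply: filterS => t; rewrite !ger0_norm ?classK2_ge0 //.
  by apply: contraTT; rewrite -!leNgt => ?; rewrite classK2_le ?lexx ?b0
    ?(ltW eps0).
- have /(cvgr0Pnorm_lt _).1/(_ (s 0 eps)) := sab0.
  rewrite -{1}[X in X < _]s0 sr // => /(_ isT).
  apply: filterS => t; rewrite !ger0_norm ?classK2_ge0 //.
  by apply: contraTT; rewrite -!leNgt => ?; rewrite classK2_le ?lexx ?a0
    ?(ltW eps0).
Qed.

End classK.

(** V is nonincreasing and bounded below, hence convergent, so the difference between V and its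
    shift tends to 0 and dominates d. *)
Lemma cvg0_decrement (R : realType) (V d : nat -> R) :
  (forall k, 0 <= V k) -> (forall k, 0 <= d k) ->
  (forall k, d k <= V k - V k.+1) -> d k @[k --> \oo] --> 0.
Proof.
move=> V0 d0 dV.
have Vni : {homo V : n m / (n <= m)%N >-> m <= n}.
  apply/nonincreasing_seqP => k.
  by rewrite -subr_ge0; exact: le_trans (dV k).
have cV : cvgn V by apply: nonincreasing_is_cvgn => //; exists 0 => _ [k _ <-].
have DV : V k - V k.+1 @[k --> \oo] --> 0.
  rewrite -[X in _ --> X](subrr (limn V)); apply: cvgB => //.
  by have := cV; rewrite -(cvg_shiftS V).
by apply: (squeeze_cvgr _ (cvg_cst 0) DV); near=> k; rewrite d0 dV.
Unshelve. all: by end_near. Qed.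

(** * Costs along trajectories *)

Section receding_horizon.
Context {R : realType} {net : network}.
Variables (dyn : dynamics R net) (C : cost_data R net).

(** Restarting along a trajectory stays on it, so all horizon costs of the baseline can be read on
    one trajectory from time 0. *)
Lemma trajD pol t (x : state net R) m l :
  traj dyn pol (t + m) (traj dyn pol t x m) l = traj dyn pol t x (m + l).
Proof. by elim: l => [|l IHl]; rewrite ?addn0 // addnS /= IHl addnA. Qed.

Lemma cvg_Wsel (T : Type) (F : set_system T) {FF : Filter F}
    (x : T -> state net R) :
  (forall i, Wsel i *m x t @[t --> F] --> (0 : 'cV[R]_(ndim i))) ->
  x t @[t --> F] --> (0 : state net R).
Proof.
move=> Wx0; apply/cvg_submxcolP => i; rewrite submxcol0.
(* Robot i is its own neighbour, so its block occurs in its neighbourhood state. Generalizing the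
   index to [i0] lets the equation with [enum_val j] be substituted inside the dependent dimension
   [sdim]. *)
suff Ux0 i0 : (exists j : 'I_#|nbr i|, enum_val j = i0) ->
    Ups i0 *m x t @[t --> F] --> (0 : 'cV[R]_(sdim i0)).
  under eq_fun => t do rewrite -[x t]mul1mx -submxcol_mul.
  by apply: Ux0; exists (enum_rank_in (nbr_refl i) i);
    rewrite enum_rankK_in ?nbr_refl.
move=> [j <-]; have /cvg_submxcolP/(_ j) := Wx0 i.
rewrite submxcol0; under eq_fun => t do rewrite mxcol_mul mxcolK.
exact.
Qed.

Lemma robot_cost_ge0 L pol t i (x : state net R) :
  0 <= robot_cost dyn C L pol t i x.
Proof.
rewrite addr_ge0 ?sumr_ge0 // => [l _|]; rewrite ?addr_ge0 //; apply: posdef_ge0.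
- exact: Qw_posdef.
- exact: Rw_posdef.
- exact: Pw_posdef.
Qed.

Lemma stage_cost_le_total_cost L pol t i (x : state net R) : (0 < L)%N ->
  qform (Qw C i) (Wsel i *m x) + qform (Rw C i) (submxcol (pol t x) i)
  <= total_cost dyn C L pol t x.
Proof.
case: L => // L _; rewrite /total_cost [leRHS](bigD1 i) //= {1}/robot_cost.
(* The stage-0 term, evaluated at x itself, is exactly the left-hand side; all other terms are
   nonnegative. *)
rewrite [in leRHS](big_ord_recl L) /= addn0 -!addrA addrA lerDl.
rewrite !addr_ge0 ?sumr_ge0 //.
- move=> l _; apply: addr_ge0; apply: posdef_ge0.
    exact: Qw_posdef.
  exact: Rw_posdef.
- exact/posdef_ge0/Pw_posdef.
- by move=> j _; exact: robot_cost_ge0.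
Qed.

Lemma cvg0_total_cost L pol (x0 : state net R) :
  traj dyn pol 0 x0 k @[k --> \oo] --> (0 : state net R) ->
  pol k (traj dyn pol 0 x0 k) @[k --> \oo] --> (0 : input net R) ->
  total_cost dyn C L pol k (traj dyn pol 0 x0 k) @[k --> \oo] --> 0.
Proof.
move=> x_0 u_0.
have shift0 p (A : 'M[R]_p) (z : nat -> 'cV[R]_p) l :
    z k @[k --> \oo] --> (0 : 'cV[R]_p) ->
    qform A (z (k + l)%N) @[k --> \oo] --> 0.
  rewrite (cvg_shiftn l (fun k => qform A (z k))) => /(cvg_qform (A := A)).
  by rewrite qform0.
have x_0' p (W : 'M[R]_(p, _)) : W *m traj dyn pol 0 x0 k @[k --> \oo] -->
    (0 : 'cV[R]_p).
  by rewrite -[X in _ --> X](mulmx0 _ W); apply: cvg_mulmx x_0; exact: cvg_cst.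
have u_0' i : submxcol (pol k (traj dyn pol 0 x0 k)) i @[k --> \oo] -->
    (0 : 'cV[R]_(idim i)).
  by rewrite -[X in _ --> X](submxcol0 _ i);
    have /cvg_submxcolP/(_ i) := u_0.
apply: cvg0_sumr => i _; rewrite -[X in _ --> X]addr0.
have trajE k l : traj dyn pol k (traj dyn pol 0 x0 k) l =
    traj dyn pol 0 x0 (k + l).
  exact: (trajD pol 0 x0 k l).
apply: cvgD.
  apply: cvg0_sumr => l _; rewrite -[X in _ --> X]addr0.
  under eq_fun do rewrite trajE.
  apply: cvgD; first exact: (shift0 _ _ (fun k => Wsel i *m traj dyn pol 0 x0 k)).
  (* After [trajE], the input at stage l is term k + l of the input sequence along the trajectory
     from time 0. *)
  exact: (shift0 _ _ (fun k => submxcol (pol k (traj dyn pol 0 x0 k)) i)).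
under eq_fun do rewrite trajE.
exact: (shift0 _ _ (fun k => Ups i *m traj dyn pol 0 x0 k)).
Qed.

Lemma cvg0_baseline_cost pol x0 : baseline dyn C pol x0 ->
  baseline_cost dyn C pol x0 k @[k --> \oo] --> 0.
Proof.
case=> _ [s sK dJ].
set x := baseline_state dyn pol x0; set u := baseline_input dyn pol x0.
have s0 : s (fnorm (x k)) (fnorm (u k)) @[k --> \oo] --> 0.
  apply: (@cvg0_decrement _ (baseline_cost dyn C pol x0)) => k.
  - by apply: sumr_ge0 => i _; exact: robot_cost_ge0.
  - by apply: (classK2_ge0 sK); exact: sqrtr_ge0.
  - by rewrite -opprB lerNr; exact/ltW/dJ.
have [] := cvg0_classK2 sK _ _ s0; try by move=> k; exact: sqrtr_ge0.
by move=> /cvg0_fnorm x_0 /cvg0_fnorm u_0; exact: cvg0_total_cost.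
Qed.

(** The policy is indexed by k because the weights are relearned at each time. Only stage 0 of each
    cost is used, where the predicted state and input are the actual ones. *)
Lemma cvg0_state_input (L : nat) (pol : nat -> policy (R := R) (net := net))
    (x : nat -> state net R) : (0 < L)%N ->
  total_cost dyn C L (pol k) k (x k) @[k --> \oo] --> 0 ->
  x k @[k --> \oo] --> (0 : state net R) /\
  pol k k (x k) @[k --> \oo] --> (0 : input net R).
Proof.
move=> L0 J0.
have Q0 i y := posdef_ge0 (Qw_posdef C i) y.
have R0 i y := posdef_ge0 (Rw_posdef C i) y.
have J_ge i k := stage_cost_le_total_cost (pol k) k i (x k) L0.
split.
  apply: cvg_Wsel => i; apply: (cvg0_qform (Qw_posdef C i)).
  apply: (squeeze_cvgr _ (cvg_cst 0) J0); near=> k.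
  by rewrite Q0 /=; apply: le_trans (J_ge i k); rewrite lerDl.
apply/cvg_submxcolP => i; rewrite submxcol0; apply: (cvg0_qform (Rw_posdef C i)).
apply: (squeeze_cvgr _ (cvg_cst 0) J0); near=> k.
by rewrite R0 /=; apply: le_trans (J_ge i k); rewrite lerDr.
Unshelve. all: by end_near. Qed.

End receding_horizon.

Theorem theorem4 (R : realType) (net : network) (dyn : dynamics R net)
  (C : cost_data R net) (ac : actor_critic R net)
  (K : forall i : 'I_(robots net), 'M[R]_(idim i, ndim i))
  (beta : 'I_(robots net) -> R)
  (Gamma : forall i : 'I_(robots net), 'M[R]_(ndim i))
  (ub : policy (R := R) (net := net)) (eb0 : state net R)
  (X : set (state net R))
  (ustar : policy (R := R) (net := net))
  (lam : nat -> forall i : 'I_(robots net), state net R -> 'cV[R]_(ndim i))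
  (wstar : weights ac)
  (e : nat -> state net R) (u : nat -> input net R) (w : nat -> weights ac) :
  terminal_condition dyn C K beta Gamma ->
  baseline dyn C ub eb0 ->
  (exists mu : forall i : 'I_(robots net), 'cV[R]_(ndim i) -> 'cV[R]_(idim i),
     stabilizing dyn (local_policy mu)) ->
  optimal_policy dyn C ustar ->
  optimal_costate dyn C X ustar lam ->
  bounded_critic C X lam wstar ->
  bounded_actor C X ustar wstar ->
  bounded_dynamics dyn X ->
  algorithm_run dyn C (baseline_cost dyn C ub eb0) e u w ->
  (forall k, X (e k)) ->
  (forall k, predicted_cost dyn C (w k.+1) k (e k)
             <= baseline_cost dyn C ub eb0 k) ->
  e @ \oo --> (0 : state net R) /\ u @ \oo --> (0 : input net R).
Proof.
move=> _ base _ _ _ _ _ _ run _ J_le.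
have uE : u = fun k => learned_policy (w k.+1) k (e k).
  by apply/funext => k; case: (run k).
rewrite uE.
(* The total cost required to vanish here is [predicted_cost] unfolded, with the weights learned at
   time k. *)
apply: (@cvg0_state_input _ _ dyn C _ (fun k => learned_policy (w k.+1)) e
  (horizon_gt0 C)).
apply: (squeeze_cvgr _ (cvg_cst 0) (cvg0_baseline_cost base)); near=> k.
rewrite J_le andbT; apply: sumr_ge0 => i _; exact: robot_cost_ge0.
Unshelve. all: by end_near. Qed.
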